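(* Let $f$ be convex, let $\mathcal{C}$ be closed and convex, let $h$ be the reference function with Bregman divergence $D$, assume $x_0\in\mathcal{C}\cap\operatorname{int}(\mathcal{X})$ and $x_\star\in\operatorname{ri}(\mathcal{C})\cap\operatorname{int}(\mathcal{X})$, and let $(x_t)_{t\ge 0}$ be the iterates of mirror Polyak, all as specified in the context. If $f$ is $G$-Lipschitz continuous relative to $h$, $G>0$, then for every integer $T\ge1$, $$ f(\bar x_T)-f_\star\le\frac{G\sqrt{2D(x_\star,x_0)}}{\sqrt T},\qquad\text{where}\quad \bar x_T:=\frac1T\sum_{t=0}^{T-1}x_t .$$
   Context: Setting: $\mathcal{X}\subseteq\mathbb{R}^d$ is convex with nonempty interior, $f:\mathcal{X}\to\mathbb{R}$ is a proper convex function, and $\mathcal{C}\subseteq\mathbb{R}^d$ is a closed convex set such that $f$ attains a finite minimum $f_\star := f(x_\star)$ over $\mathcal{X}\cap\mathcal{C}$ at a point $x_\star\in\mathcal{X}\cap\mathcal{C}$. $g(x)\in\partial f(x)$ denotes a fixed selection of a subgradient of $f$ at $x$. The reference function $h:\mathcal{X}\to\mathbb{R}$ is a convex function of Legendre type with domain $\mathcal{X}$ (closed proper convex, essentially smooth, strictly convex on $\operatorname{int}(\mathcal{X})$; essentially smooth means that $h$ is differentiable on the nonempty set $\operatorname{int}(\mathcal{X})$ and $\|\nabla h(x_k)\|\to\infty$ whenever $(x_k)$ is a sequence in $\operatorname{int}(\mathcal{X})$ converging to a boundary point of $\mathcal{X}$). Its Bregman divergence is $D(x,y):=h(x)-h(y)-\langle\nabla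 h(y),x-y\rangle$ for $x\in\mathcal{X}$, $y\in\operatorname{int}(\mathcal{X})$. $\operatorname{ri}$ denotes relative interior, $\operatorname{int}$ interior. Mirror Polyak: starting from $x_0\in\mathcal{C}\cap\operatorname{int}(\mathcal{X})$, for every $t\ge0$, $$x_{t+1}\in\arg\min_{x\in\mathcal{X}\cap\mathcal{C}} D(x,x_t)\quad\text{such that}\quad f(x_t)+\langle g(x_t),x-x_t\rangle=f_\star .$$ Relative Lipschitz continuity: $f$ is $G$-Lipschitz continuous relative to $h$ if $\langle g(x),x-y\rangle\le G\sqrt{2D(y,x)}$ for all $x\in\operatorname{int}(\mathcal{X})$, $y\in\mathcal{X}$. *)

(* Defs.v *)
From mathcomp Require Export all_boot all_order all_algebra.
From mathcomp Require Export all_classical all_reals all_analysis.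
Export numFieldNormedType.Exports.

Set Implicit Arguments.
Unset Strict Implicit.
Unset Printing Implicit Defensive.

Import Order.TTheory GRing.Theory Num.Theory.

Local Open Scope classical_set_scope.
Local Open Scope ring_scope.
Local Open Scope convex_scope.

(* A function on a subset X of R^d is represented by a total function together
   with the set X; derivatives are meaningful only at interior points of X. *)

Definition dotp (R : realType) (d : nat) (u v : 'rV[R]_d) : R :=
  \sum_(i < d) u 0 i * v 0 i.

(* The norm `|_| of the library on row vectors is the sup norm. *)
Definition enorm (R : realType) (d : nat) (u : 'rV[R]_d) : R :=
  Num.sqrt (dotp u u).

Definition gradient (R : realType) (d : nat) (h : 'rV[R]_d -> R)
    (y : 'rV[R]_d) : 'rV[R]_d :=
  \row_(i < d) 'D_(delta_mx 0 i) h y.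

Definition bregman (R : realType) (d : nat) (h : 'rV[R]_d -> R)
    (x y : 'rV[R]_d) : R :=
  h x - h y - dotp (gradient h y) (x - y).

Definition strictly_convex_function (R : realType) (d : nat)
    (D : set 'rV[R]_d) (f : 'rV[R]_d -> R) : Prop :=
  forall (t : {i01 R}) (x y : convex_lmodType 'rV[R]_d),
    D x -> D y -> x != y -> 0 < t%:num -> t%:num < 1 ->
    f (x <| t |> y) < (f x : R^o) <| t |> (f y : R^o).

Definition ext_fun (R : realType) (d : nat) (X : set 'rV[R]_d)
    (f : 'rV[R]_d -> R) (x : 'rV[R]_d) : \bar R :=
  if x \in X then (f x)%:E else +oo%E.

Definition essentially_smooth (R : realType) (d : nat) (X : set 'rV[R]_d)
    (h : 'rV[R]_d -> R) : Prop :=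
  [/\ X° !=set0,
      forall x : 'rV[R]_d, X° x -> differentiable h x
    & forall (u : nat -> 'rV[R]_d) (p : 'rV[R]_d),
        (forall k, X° (u k)) -> (closure X `\` X°) p -> u k @[k --> \oo] --> p ->
        enorm (gradient h (u k)) @[k --> \oo] --> +oo].

(* A proper convex function is closed iff it is lower semicontinuous; properness
   itself holds because h is real-valued on X, which is nonempty. *)
Definition legendre (R : realType) (d : nat) (X : set 'rV[R]_d)
    (h : 'rV[R]_d -> R) : Prop :=
  [/\ convex_function X h,
      lower_semicontinuous (ext_fun X h),
      essentially_smooth X h
    & strictly_convex_function X° h].

Definition subdifferential (R : realType) (d : nat) (X : set 'rV[R]_d)
    (f : 'rV[R]_d -> R) (x : 'rV[R]_d) : set 'rV[R]_d :=
  [set v | forall y, X y -> f x + dotp v (y - x) <= f y].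

Definition affine_set (R : realType) (d : nat) (A : set 'rV[R]_d) : Prop :=
  forall (x y : 'rV[R]_d) (t : R), A x -> A y -> A (t *: x + (1 - t) *: y).

Definition affine_hull (R : realType) (d : nat) (A : set 'rV[R]_d) :
    set 'rV[R]_d :=
  smallest (@affine_set R d) A.

Definition relative_interior (R : realType) (d : nat) (A : set 'rV[R]_d) :
    set 'rV[R]_d :=
  [set x | A x /\ \forall y \near x, affine_hull A y -> A y].

Definition argmin (R : realType) (T : Type) (S : set T) (F : T -> R) : set T :=
  [set x | S x /\ forall y, S y -> F x <= F y].

Definition mirror_polyak (R : realType) (d : nat) (X C : set 'rV[R]_d)
    (f : 'rV[R]_d -> R) (g : 'rV[R]_d -> 'rV[R]_d) (h : 'rV[R]_d -> R)
    (fstar : R) (x : nat -> 'rV[R]_d) : Prop :=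
  forall t : nat,
    argmin [set y | (X `&` C) y /\ f (x t) + dotp (g (x t)) (y - x t) = fstar]
      (fun y => bregman h y (x t)) (x t.+1).

Definition relative_lipschitz (R : realType) (d : nat) (X : set 'rV[R]_d)
    (g : 'rV[R]_d -> 'rV[R]_d) (h : 'rV[R]_d -> R) (G : R) : Prop :=
  forall x y : 'rV[R]_d, X° x -> X y ->
    dotp (g x) (x - y) <= G * Num.sqrt (2 * bregman h y x).

(* Main.v *)
Require Import Defs.
From mathcomp Require Import ring lra.

(** The theorem rests on one descent inequality: as long as the iterates stay in
    C and in the interior of X,
      D(xstar, x_(k+1)) <= D(xstar, x_k) - D(x_(k+1), x_k).
    Relative Lipschitz continuity, applied to the pair (x_k, x_(k+1)) on the
    hyperplane where the linearisation of f equals fstar, turns the last term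
    into the optimality gap:
      (f(x_k) - fstar)^2 <= 2 G^2 D(x_(k+1), x_k).
    Telescoping bounds the sum of the squared gaps by 2 G^2 D(xstar, x_0), and
    Cauchy-Schwarz followed by Jensen's inequality gives the rate for the average
    iterate.

    For the descent inequality, xstar need not lie on the hyperplane that defines
    x_(k+1): the subgradient inequality only puts it in the half-space where the
    linearisation is at most fstar, while x_k lies on the other side. But D(., x_k)
    is convex and minimal at x_k, so moving from a point of the half-space back
    towards x_k until the hyperplane is met cannot increase it; hence x_(k+1) also
    minimises D(., x_k) over the half-space ([argmin_bregman_halfspace]). That set
    is convex and contains xstar, so the first-order condition at x_(k+1) and the
    three-point identity conclude ([argmin_bregman_three_point]).

    The first-order condition needs x_(k+1) to be interior to X
    ([argmin_bregman_interior]). If it were a boundary point p, then along the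
    segment from p to the interior point xstar the slopes of h would be bounded
    below by minimality of p; combined with an upper bound for h on a ball around
    xstar, this bounds the gradients of h near p ([enorm_gradient_le]), which
    contradicts essential smoothness. *)

Set Implicit Arguments.
Unset Strict Implicit.
Unset Printing Implicit Defensive.

Import Order.TTheory GRing.Theory Num.Theory.

Local Open Scope classical_set_scope.
Local Open Scope ring_scope.

(** * Inner product and Euclidean norm *)

Section DotProduct.
Variables (R : realType) (d : nat).
Implicit Types u v w : 'rV[R]_d.

Lemma dotpDr u v w : dotp u (v + w) = dotp u v + dotp u w.
Proof. by rewrite /dotp -big_split; apply: eq_bigr => i _; rewrite mxE mulrDr. Qed.

Lemma dotpZr u v a : dotp u (a *: v) = a * dotp u v.
Proof. by rewrite /dotp mulr_sumr; apply: eq_bigr => i _; rewrite mxE mulrCA. Qed.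

Lemma dotpNr u v : dotp u (- v) = - dotp u v.
Proof. by rewrite -scaleN1r dotpZr mulN1r. Qed.

Lemma dotpBr u v w : dotp u (v - w) = dotp u v - dotp u w.
Proof. by rewrite dotpDr dotpNr. Qed.

Lemma dotp_ge0 u : 0 <= dotp u u.
Proof. by apply: sumr_ge0 => i _; rewrite -expr2 sqr_ge0. Qed.

Lemma sqr_enorm u : enorm u ^+ 2 = dotp u u.
Proof. by rewrite sqr_sqrtr // dotp_ge0. Qed.

Lemma norm_le_enorm u : `|u| <= enorm u.
Proof.
have [->|u0] := eqVneq `|u| 0; first exact: sqrtr_ge0.
have [[i j] u_ij] := mx_norm_neq0 u0.
rewrite [`|u|]u_ij /enorm -sqrtr_sqr ler_wsqrtr // expr2 /= (ord1 i).
by rewrite /dotp (bigD1 j) //= lerDl sumr_ge0 // => k _; rewrite -expr2 sqr_ge0.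
Qed.

End DotProduct.

(** * Convexity along segments *)

Section Segments.
Variables (R : realType) (d : nat) (X : set 'rV[R]_d).
Implicit Types (x y z v : 'rV[R]_d) (t : R).


Lemma conv_segment (l : {i01 R}) x y :
  conv l (y : convex_lmodType 'rV[R]_d) x = x + l%:num *: (y - x).
Proof.
by rewrite scalerBr addrCA -[X in _ + (X - _)]scale1r -scalerBl.
Qed.

Lemma convex_set_segment x y t : convex_set X -> X x -> X y -> 0 <= t <= 1 ->
  X (x + t *: (y - x)).
Proof.
move=> cX Xx Xy /andP[t0 t1].
have := cX y x (Itv01 t0 t1) (mem_set Xy) (mem_set Xx).
by rewrite inE conv_segment.
Qed.

Lemma segment_convex_set :
  (forall x y t, X x -> X y -> 0 <= t <= 1 -> X (x + t *: (y - x))) ->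
  convex_set X.
Proof.
move=> segX x y l /set_mem Xx /set_mem Xy; rewrite inE conv_segment.
by apply: segX => //; rewrite ge0 le1.
Qed.

Lemma convex_function_segment (f : 'rV[R]_d -> R) x y t :
  convex_function X f -> X x -> X y -> 0 <= t <= 1 ->
  f (x + t *: (y - x)) <= f x + t * (f y - f x).
Proof.
move=> cf Xx Xy /andP[t0 t1].
have : f (x + t *: (y - x)) <= t * f y + (1 - t) * f x.
  rewrite -(conv_segment (Itv01 t0 t1)).
  exact: cf (Itv01 t0 t1) y x (mem_set Xy) (mem_set Xx).
lra.
Qed.

(** The homothety of centre [x] and ratio [t] maps a ball around [z] contained in
    [X] to a ball around the new point, and convexity keeps its image in [X]. *)
Lemma interior_segment x z t : convex_set X -> X x -> X° z -> 0 < t <= 1 ->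
  X° (x + t *: (z - x)).
Proof.
move=> cX Xx /nbhs_ballP[e /= e0 zX] /andP[t0 t1].
apply/nbhs_ballP; exists (t * e) => /=; first exact: mulr_gt0.
move=> w; rewrite -ball_normE /= => xw.
have -> : w = x + t *: ((x + t^-1 *: (w - x)) - x).
  by rewrite [x + _ - x]addrC addKr scalerA divff ?gt_eqF // scale1r addrC subrK.
apply: convex_set_segment => //; last by rewrite ltW.
apply: zX; rewrite -ball_normE /=.
have -> : z - (x + t^-1 *: (w - x)) = t^-1 *: (x + t *: (z - x) - w).
  by apply/rowP => i; rewrite !mxE; field; rewrite gt_eqF.
by rewrite normrZ gtr0_norm ?invr_gt0 // mulrC ltr_pdivrMr // mulrC.
Qed.

(** Induction on the number of points: the mean of [T.+2] points lies on the
    segment from the mean of the first [T.+1] to the last one, with parameter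
    [T.+2%:R^-1]. Membership in [X] is carried along because convexity of [f] may
    only be used at points of [X]. *)
Lemma jensen_average (f : 'rV[R]_d -> R) (x : nat -> 'rV[R]_d) (T : nat) :
  convex_set X -> convex_function X f -> (forall k, X (x k)) -> (0 < T)%N ->
  X (T%:R^-1 *: \sum_(0 <= k < T) x k) /\
  f (T%:R^-1 *: \sum_(0 <= k < T) x k) <= T%:R^-1 * \sum_(0 <= k < T) f (x k).
Proof.
move=> cX cf Xx; case: T => // T _; elim: T => [|T [IHX IHf]].
  by rewrite invr1 !big_nat1 scale1r mul1r.
set m := _ *: _ in IHX IHf; set s := T.+2%:R^-1 : R.
have s01 : 0 <= s <= 1 by rewrite invr_ge0 ler0n invf_le1 ?ltr0n // ler1n.
have sT : s * T.+1%:R = 1 - s.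
  by rewrite -(addrK 1 T.+1%:R) natr1 mulrBr mulr1 mulVf // pnatr_eq0.
have -> : s *: \sum_(0 <= k < T.+2) x k = m + s *: (x T.+1 - m).
  have xm : \sum_(0 <= k < T.+1) x k = T.+1%:R *: m.
    by rewrite scalerA mulfV ?scale1r // pnatr_eq0.
  rewrite big_nat_recr //= xm scalerDr scalerA sT.
  by apply/rowP => j; rewrite !mxE; ring.
split; first exact: convex_set_segment.
apply: (le_trans (convex_function_segment cf IHX (Xx _) s01)).
rewrite big_nat_recr //=; set q := \sum_(0 <= k < T.+1) _ in IHf *.
have -> : s * (q + f (x T.+1)) = (1 - s) * (T.+1%:R^-1 * q) + s * f (x T.+1).
  by rewrite -sT mulrDr -(mulrA s) mulVKf // pnatr_eq0.
have s1 : 0 <= 1 - s by rewrite subr_ge0; case/andP: s01.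
have := ler_wpM2l s1 IHf; move: (T.+1%:R^-1 * q) (f m) (f _) => a b c; lra.
Qed.
End Segments.

Lemma convex_setI (R : realType) (d : nat) (A B : set 'rV[R]_d) :
  convex_set A -> convex_set B -> convex_set (A `&` B).
Proof.
move=> cA cB; apply: segment_convex_set => x y t [Ax Bx] [Ay By] t01.
by split; exact: convex_set_segment.
Qed.

Lemma convex_set_halfspace (R : realType) (d : nat) (a q : 'rV[R]_d) (c : R) :
  convex_set [set y : 'rV[R]_d | dotp a (y - q) <= c].
Proof.
apply: segment_convex_set => x y t /=; rewrite !(dotpBr, dotpDr, dotpZr) => xc yc.
move=> /andP[t0 t1].
have := ler_wpM2l t0 yc; have : 0 <= 1 - t by rewrite subr_ge0.
by move=> /ler_wpM2l /(_ _ _ xc); lra.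
Qed.


(** * One-sided slopes and the gradient *)

Section Gradients.
Variables (R : realType) (d : nat) (h : 'rV[R]_d -> R).
Implicit Types (y v : 'rV[R]_d).

Lemma dotp_gradient y v : differentiable h y -> dotp (gradient h y) v = 'D_v h y.
Proof.
move=> hy; rewrite deriveE // {2}[v]row_sum_delta linear_sum.
apply: eq_bigr => i _.
by rewrite mxE deriveE // linearZ /= mulrC.
Qed.

Lemma slope_cvg y v : differentiable h y ->
  t^-1 * (h (y + t *: v) - h y) @[t --> 0^'+] --> dotp (gradient h y) v.
Proof.
move=> hy; rewrite dotp_gradient //.
have -> : (fun t => t^-1 * (h (y + t *: v) - h y)) =
    (fun t => t^-1 *: ((h \o shift y) (t *: v) - h y)).
  by apply/funext => t /=; rewrite [_ + y]addrC.
apply: cvg_dnbhs_at_right; exact: diff_derivable.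
Qed.

(** The slopes of [h] at [y] in direction [v] tend to the directional derivative,
    so a bound on all of them passes to the limit. *)
Lemma le_dotp_gradient y v c : differentiable h y ->
  (forall t, 0 < t <= 1 -> t * c <= h (y + t *: v) - h y) ->
  c <= dotp (gradient h y) v.
Proof.
move=> hy ch.
apply: (cvgr_to_ge (slope_cvg (v := v) hy)).
near=> t.
have t0 : 0 < t by near: t; exact: nbhs_right_gt.
rewrite mulrC ler_pdivlMr // mulrC ch // t0 /=.
by near: t; apply: nbhs_right_le.
Unshelve. all: by end_near.
Qed.

Lemma dotp_gradient_le y v c : differentiable h y ->
  (forall t, 0 < t <= 1 -> h (y + t *: v) - h y <= t * c) ->
  dotp (gradient h y) v <= c.
Proof.
move=> hy ch.
apply: (cvgr_to_le (slope_cvg (v := v) hy)).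
near=> t.
have t0 : 0 < t by near: t; exact: nbhs_right_gt.
rewrite mulrC ler_pdivrMr // mulrC ch // t0 /=.
by near: t; apply: nbhs_right_le.
Unshelve. all: by end_near.
Qed.
End Gradients.

(** * Bregman divergence of a Legendre function *)

Section Bregman.
Variables (R : realType) (d : nat) (X : set 'rV[R]_d) (h : 'rV[R]_d -> R).
Hypothesis (h_legendre : legendre X h).
Implicit Types (y z p q : 'rV[R]_d) (S : set 'rV[R]_d).

Let h_convex : convex_function X h. Proof. by case: h_legendre. Qed.

Let h_diff y : X° y -> differentiable h y.
Proof. by move=> Xy; case: h_legendre => _ _ [_ + _] _; apply. Qed.

Lemma bregman_ge0 y q : X y -> X° q -> 0 <= bregman h y q.
Proof.
move=> Xy Xq; rewrite subr_ge0; apply: dotp_gradient_le (h_diff Xq) _.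
move=> t /andP[t0 t1]; rewrite lerBlDl.
by apply: convex_function_segment => //; [exact: interior_subset|rewrite ltW].
Qed.

(** [bregman h ^~ q] is convex and minimal at [q], hence nondecreasing along rays
    issued from [q]. *)
Lemma bregman_segment_le y q t : X y -> X° q -> 0 <= t <= 1 ->
  bregman h (q + t *: (y - q)) q <= bregman h y q.
Proof.
move=> Xy Xq t01; have := bregman_ge0 Xy Xq.
have := convex_function_segment h_convex (interior_subset Xq) Xy t01.
case/andP: t01 => t0 t1.
rewrite /bregman (addrC q) addrK dotpZr; set D := dotp _ _ => hq D0.
have : 0 <= (1 - t) * (h y - h q - D) by rewrite mulr_ge0 // subr_ge0.
by lra.
Qed.

Lemma bregman_sub y p q :
  bregman h y q - bregman h p q = h y - h p - dotp (gradient h q) (y - p).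
Proof. by rewrite /bregman !dotpBr; ring. Qed.

Lemma argmin_bregman_ge S p q : argmin S (bregman h ^~ q) p ->
  forall y, S y -> 0 <= h y - h p - dotp (gradient h q) (y - p).
Proof. by move=> [_ pmin] y Sy; rewrite -bregman_sub subr_ge0; exact: pmin. Qed.

Lemma three_point_identity y p q :
  bregman h y q - bregman h y p - bregman h p q =
  dotp (gradient h p) (y - p) - dotp (gradient h q) (y - p).
Proof. by rewrite /bregman !dotpBr; ring. Qed.

(** A point [y] of the half-space can be pulled back towards [q], which lies on the
    other side, until it meets the hyperplane; this does not increase the
    divergence from [q]. *)
Lemma argmin_bregman_halfspace (K : set 'rV[R]_d) (a : 'rV[R]_d) (c : R) p q :
  convex_set K -> K `<=` X -> K q -> X° q -> c <= 0 ->
  argmin (K `&` [set y : 'rV[R]_d | dotp a (y - q) = c]) (bregman h ^~ q) p ->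
  argmin (K `&` [set y : 'rV[R]_d | dotp a (y - q) <= c]) (bregman h ^~ q) p.
Proof.
move=> cK KX Kq Xq c0 [[Kp pc] pmin]; split=> [|y [Ky yc]]; first by rewrite /= pc.
have [ay0|ay0] := eqVneq (dotp a (y - q)) 0.
  by apply: pmin; split => //=; move: yc ay0 => /=; lra.
(* The parameter at which the segment from q to y crosses the hyperplane. *)
pose t := c / dotp a (y - q).
have aylt : dotp a (y - q) < 0 by rewrite lt_neqAle ay0 (le_trans yc).
have t01 : 0 <= t <= 1.
  by rewrite ler_ndivlMr // ler_ndivrMr // mul0r c0 mul1r.
apply: le_trans (bregman_segment_le (KX _ Ky) Xq t01).
apply: pmin; split; first exact: convex_set_segment.
by rewrite /= (addrC q) addrK dotpZr divfK.
Qed.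

(** The gradient inequality at [y], tested at the point of the ball around [z] lying
    in the direction of the gradient itself. The radius is halved because that
    point must lie in the open ball. *)
Lemma enorm_gradient_le y z (r M : R) : X° y -> 0 < r ->
  (forall w, `|z - w| < r -> X w /\ h w <= M) ->
  r / 2 * enorm (gradient h y) <= M - h y - dotp (gradient h y) (z - y).
Proof.
move=> Xy r0 ball_zr; set g := gradient h y; set N := enorm g.
have N0 : 0 <= N := sqrtr_ge0 _.
have [->|Nn0] := eqVneq N 0.
  have [Xz hz] : X z /\ h z <= M by apply: ball_zr; rewrite subrr normr0.
  by have := bregman_ge0 Xz Xy; rewrite /bregman -/g; lra.
pose w := z + (r / 2 / N) *: g.
have [Xw hw] : X w /\ h w <= M.
  apply: ball_zr; rewrite opprD addrA subrr sub0r normrN normrZ.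
  have s0 : 0 <= r / 2 / N by rewrite !divr_ge0 // ltW.
  rewrite ger0_norm //; apply: (@le_lt_trans _ _ (r / 2)); last by lra.
  by rewrite -[leRHS](divfK Nn0) ler_wpM2l // norm_le_enorm.
have := bregman_ge0 Xw Xy; rewrite /bregman -/g.
have -> : w - y = (z - y) + (r / 2 / N) *: g by rewrite addrAC.
rewrite dotpDr dotpZr -sqr_enorm -/N expr2 mulrA divfK //.
by lra.
Qed.

(** If the minimiser [p] were on the boundary of [X], then along the segment from
    [p] to [z] minimality would bound the slope of [h] towards [z] from below by
    its value [c] for the gradient at [q], and [enorm_gradient_le] would bound the
    gradients; essential smoothness makes them blow up. *)
Lemma argmin_bregman_interior S p q z : convex_set X -> convex_set S -> S `<=` X ->
  S z -> X° z -> argmin S (bregman h ^~ q) p -> X° p.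
Proof.
move=> cX cS SX Sz Xz pargmin; have [Sp _] := pargmin.
have pmin := argmin_bregman_ge pargmin; apply: contrapT => pX.
have [r r0 ball_zr] : exists2 r, 0 < r &
    forall w, `|z - w| < r -> X w /\ h w <= h z + 1.
  have h_near : \forall w \near z, h w <= h z + 1.
    have h_cont : h w @[w --> z] --> h z.
      exact: differentiable_continuous (h_diff Xz).
    by apply: (cvgr_le _ h_cont); rewrite ltrDl.
  have : nbhs z (X `&` [set w | h w <= h z + 1]) by exact: filterI.
  by case/nbhs_ballP => r /= r0 zr; exists r => // w zw; apply: zr; rewrite -ball_normE.
pose u k : 'rV[R]_d := p + harmonic k *: (z - p).
have harm01 k : 0 < (harmonic k : R) <= 1.
  by rewrite /harmonic invr_gt0 ltr0n /= invf_le1 ?ltr0n // ler1n.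
have Xu k : X° (u k) by apply: interior_segment => //; exact: SX.
have u_cvg : u k @[k --> \oo] --> p.
  rewrite -[X in _ --> X]addr0 -[X in _ + X](scale0r (z - p)).
  apply: cvgD; first exact: cvg_cst.
  by apply: cvgZr_tmp; exact: cvg_harmonic.
pose c := dotp (gradient h q) (z - p).
have h_ge k : 0 <= h (u k) - h p - harmonic k * c.
  have /andP[s0 s1] := harm01 k.
  have := pmin (u k) _; rewrite [u k - p]addrC addKr dotpZr; apply.
  by apply: convex_set_segment => //; rewrite ltW.
(* The gradient inequality at u k tested at p bounds the slope from below by the
   difference quotient that h_ge controls. *)
have slope_ge k : c <= dotp (gradient h (u k)) (z - p).
  have /andP[s0 s1] := harm01 k; rewrite -subr_ge0 -(pmulr_rge0 _ s0).
  have := h_ge k; have := bregman_ge0 (SX _ Sp) (Xu k).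
  rewrite /bregman -[p - u k]opprB [u k - p]addrC addKr dotpNr dotpZr; lra.
pose B := h z + 1 - h p - c.
have grad_le k : r / 2 * enorm (gradient h (u k)) <= B.
  have /andP[s0 s1] := harm01 k.
  apply: le_trans (enorm_gradient_le (Xu k) r0 ball_zr) _.
  have -> : z - u k = (1 - harmonic k) *: (z - p).
    by apply/rowP => i; rewrite !mxE; ring.
  rewrite dotpZr; have := h_ge k; have := slope_ge k; set D := dotp _ _ => cD hk.
  have : 0 <= (1 - harmonic k) * (D - c) by rewrite mulr_ge0 // subr_ge0.
  by rewrite /B; lra.
have [_ _ [_ _ blowup] _] := h_legendre.
have /cvgryPgt/(_ (B / (r / 2))) grad_gt :=
  blowup u p Xu (conj (subset_closure (SX _ Sp)) pX) u_cvg.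
have [k] := filter_ex grad_gt.
by rewrite ltr_pdivrMr ?divr_gt0 // mulrC ltNge grad_le.
Qed.

(** Generalised Pythagorean inequality for the Bregman projection [p] of [q] on
    [S]: the first-order condition at [p] signs the right-hand side of
    [three_point_identity]. *)
Lemma argmin_bregman_three_point S p q y : convex_set S -> S `<=` X ->
  X° p -> argmin S (bregman h ^~ q) p -> S y ->
  bregman h y p <= bregman h y q - bregman h p q.
Proof.
move=> cS SX Xp pargmin Sy; have [Sp _] := pargmin.
have pmin := argmin_bregman_ge pargmin.
have : dotp (gradient h q) (y - p) <= dotp (gradient h p) (y - p).
  apply: le_dotp_gradient (h_diff Xp) _ => t /andP[t0 t1].
  have := pmin (p + t *: (y - p)) _; rewrite [p + _ - p]addrC addKr dotpZr subr_ge0; apply.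
  by apply: convex_set_segment => //; rewrite ltW.
by have := three_point_identity y p q; lra.
Qed.
End Bregman.

(** * Convergence rate *)

(** Cauchy-Schwarz against the constant sequence, from the nonnegativity of the
    empirical variance. *)
Lemma sqr_sum_le (R : realType) (a : nat -> R) (T : nat) :
  (\sum_(0 <= k < T) a k) ^+ 2 <= T%:R * \sum_(0 <= k < T) a k ^+ 2.
Proof.
case: T => [|T]; first by rewrite !big_nil mulr0 expr0n.
set n := T.+1; set s := \sum_(0 <= k < n) a k.
have n0 : 0 < n%:R :> R by rewrite ltr0n.
have : 0 <= \sum_(0 <= k < n) (n%:R * a k - s) ^+ 2.
  by apply: sumr_ge0 => k _; exact: sqr_ge0.
have -> : \sum_(0 <= k < n) (n%:R * a k - s) ^+ 2 =
    n%:R * (n%:R * (\sum_(0 <= k < n) a k ^+ 2) - s ^+ 2).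
  transitivity (\sum_(0 <= k < n)
      (n%:R ^+ 2 * a k ^+ 2 - (2 * n%:R * s) * a k + s ^+ 2)).
    by apply: eq_bigr => k _; ring.
  rewrite big_split /= sumrB -!mulr_sumr sumr_const_nat subn0 -/s -mulr_natl.
  by ring.
by rewrite pmulr_rge0 // subr_ge0.
Qed.

Theorem theorem8 (R : realType) (d : nat) (X C : set 'rV[R]_d)
  (f : 'rV[R]_d -> R) (g : 'rV[R]_d -> 'rV[R]_d) (h : 'rV[R]_d -> R)
  (xstar : 'rV[R]_d) (x : nat -> 'rV[R]_d) (G : R)
  (X_convex : convex_set X)
  (X_interior : X° !=set0)
  (f_convex : convex_function X f)
  (g_subgradient : forall y : 'rV[R]_d, X° y -> subdifferential X f y (g y))
  (C_closed : closed C)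
  (C_convex : convex_set C)
  (h_legendre : legendre X h)
  (xstar_min : argmin (X `&` C) f xstar)
  (xstar_int : (relative_interior C `&` X°) xstar)
  (x0_int : (C `&` X°) (x 0%N))
  (x_iterates : mirror_polyak X C f g h (f xstar) x)
  (G_gt0 : 0 < G)
  (f_lipschitz : relative_lipschitz X g h G)
  (T : nat) (T_ge1 : (1 <= T)%N) :
  f (T%:R^-1 *: \sum_(0 <= t < T) x t) - f xstar <=
    G * Num.sqrt (2 * bregman h xstar (x 0%N)) / Num.sqrt T%:R.
Proof.
case: xstar_int => _ Xs; case: xstar_min => [[Xxs Cxs] f_ge].
pose K := X `&` C; have cK : convex_set K by exact: convex_setI.
have KX : K `<=` X by move=> y [].
pose gap k := f (x k) - f xstar.
(* The half-space version of the projection set: it contains xstar, which the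
   hyperplane itself may miss. *)
pose S k := K `&` [set y : 'rV[R]_d | dotp (g (x k)) (y - x k) <= - gap k].
have SX k : S k `<=` X by move=> y [/KX].
have cS k : convex_set (S k).
  by apply: convex_setI => //; exact: convex_set_halfspace.
have Sxs k : X° (x k) -> S k xstar.
  move=> Xk; split=> //; have := g_subgradient _ Xk _ Xxs; rewrite /gap /=; lra.
have xmin k : X° (x k) -> K (x k) ->
    argmin (S k) (bregman h ^~ (x k)) (x k.+1).
  move=> Xk Kk.
  have gap_le0 : - gap k <= 0 by rewrite oppr_le0 subr_ge0 f_ge.
  apply: (argmin_bregman_halfspace h_legendre cK KX Kk Xk gap_le0).
  have [[Kk1 hyp] xk1min] := x_iterates k.
  split=> [|y [Ky yhyp]]; first by split=> //; rewrite /gap /=; lra.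
  by apply: xk1min; split=> //; move: yhyp; rewrite /gap /=; lra.
have x_in k : K (x k) /\ X° (x k).
  elim: k => [|k [Kk Xk]].
    by case: x0_int => C0 X0; do 2?split=> //; exact: interior_subset.
  split; first by have [[]] := x_iterates k.
  exact: (argmin_bregman_interior h_legendre X_convex (cS k) (SX k) (Sxs k Xk)
    Xs (xmin k Xk Kk)).
have gap_ge0 k : 0 <= gap k by rewrite subr_ge0 f_ge //; have [] := x_in k.
have bregman_progress k : bregman h (x k.+1) (x k) <=
    bregman h xstar (x k) - bregman h xstar (x k.+1).
  have [[Kk Xk] [_ Xk1]] := (x_in k, x_in k.+1).
  have := argmin_bregman_three_point h_legendre (cS k) (SX k) Xk1
    (xmin k Xk Kk) (Sxs k Xk).
  by lra.
have sqr_gap_le k : gap k ^+ 2 <= 2 * G ^+ 2 * bregman h (x k.+1) (x k).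
  have [[Kk Xk] [Kk1 Xk1]] := (x_in k, x_in k.+1).
  have D0 := bregman_ge0 h_legendre (KX _ Kk1) Xk.
  have gapG : gap k <= G * Num.sqrt (2 * bregman h (x k.+1) (x k)).
    apply: le_trans (f_lipschitz _ _ Xk (KX _ Kk1)).
    have [[_ hyp] _] := x_iterates k.
    by rewrite -opprB dotpNr /gap; lra.
  have -> : 2 * G ^+ 2 * bregman h (x k.+1) (x k) =
      (G * Num.sqrt (2 * bregman h (x k.+1) (x k))) ^+ 2.
    by rewrite exprMn sqr_sqrtr ?mulr_ge0 //; ring.
  by rewrite ler_sqr ?nnegrE ?mulr_ge0 ?sqrtr_ge0 // ltW.
have sum_sqr_gap :
    \sum_(0 <= k < T) gap k ^+ 2 <= 2 * G ^+ 2 * bregman h xstar (x 0%N).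
  have DT : 0 <= bregman h xstar (x T).
    by apply: (bregman_ge0 h_legendre) => //; have [] := x_in T.
  have G2 : 0 <= 2 * G ^+ 2 by rewrite mulr_ge0 // sqr_ge0.
  apply: (@le_trans _ _ (\sum_(0 <= k < T) 2 * G ^+ 2 *
    (bregman h xstar (x k) - bregman h xstar (x k.+1)))).
    by apply: ler_sum => k _; apply: le_trans (sqr_gap_le k) _; exact: ler_wpM2l.
  rewrite -mulr_sumr ler_wpM2l //.
  rewrite (telescope_sumr_eq (fun k => - bregman h xstar (x k))) //; first by lra.
  by move=> k _; rewrite opprK addrC.
have T0 : 0 < T%:R :> R by rewrite ltr0n.
have [_ jensen] :=
  jensen_average X_convex f_convex (fun k => KX _ (x_in k).1) T_ge1.
have avg_le : f (T%:R^-1 *: \sum_(0 <= t < T) x t) - f xstar <=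
    T%:R^-1 * \sum_(0 <= k < T) gap k.
  rewrite sumrB sumr_const_nat subn0 -[f xstar *+ T]mulr_natl mulrBr mulKf ?gt_eqF //.
  by rewrite lerD2r.
apply: le_trans avg_le _.
have D0 : 0 <= bregman h xstar (x 0%N).
  by apply: (bregman_ge0 h_legendre) => //; case: x0_int.
have rhs0 : 0 <= G * Num.sqrt (2 * bregman h xstar (x 0%N)) / Num.sqrt T%:R.
  by rewrite divr_ge0 ?mulr_ge0 ?sqrtr_ge0 // ltW.
rewrite -ler_sqr ?nnegrE //; last by rewrite mulr_ge0 ?invr_ge0 ?ler0n // sumr_ge0.
rewrite !exprMn !exprVn !sqr_sqrtr ?mulr_ge0 ?ler0n //.
apply: (@le_trans _ _ ((T%:R ^+ 2)^-1 *
  (T%:R * (2 * G ^+ 2 * bregman h xstar (x 0%N))))).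
  rewrite ler_wpM2l ?invr_ge0 ?sqr_ge0 //; apply: le_trans (sqr_sum_le _ _) _.
  by rewrite ler_wpM2l ?ler0n.
rewrite le_eqVlt; apply/orP; left; apply/eqP; field.
by rewrite gt_eqF.
Qed.
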